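(* Let $m\ge 3$ be an integer. Let $P_1$ be a partial algorithm from natural numbers to $\{0,1\}$ that is not extendable to a totally defined algorithm, for $2\le i\le m$ let $P_i$ be the algorithm that runs $P_{i-1}$ one step late, and for each natural number $n$ let $b_n^1,b_n^2,\dots,b_n^m$ be the constructive real numbers built from $P_1,\dots,P_m$ as in the context. Let $p$ and $q$ be rational numbers such that $p<q$. Then it is undecidable whether $M_p(b_n^1,b_n^2,\dots,b_n^m)=M_q(b_n^1,b_n^2,\dots,b_n^m)$ or $M_p(b_n^1,b_n^2,\dots,b_n^m)<M_q(b_n^1,b_n^2,\dots,b_n^m)$; that is, there is no algorithm which, for every natural number $n$, terminates and correctly decides which of these two relations holds.
   Context: ''Algorithm'' means a (partial) computable function on natural numbers given by a program; ''totally defined'' means that it terminates on every input. $P_1$ is a partially defined algorithm taking values in $\{0,1\}$ such that no total computable function $\mathbb{N}\to\{0,1\}$ agrees with $P_1$ on the whole domain of $P_1$. A program computing $P_1$ is fixed, so that one can check effectively whether $P_1$ has finished working on input $n$ by step $k$; if $P_1$ terminates on $n$, it finishes at a definite step. For $2\le i\le m$, $P_i$ is the algorithm that runs $P_{i-1}$ one step late on the same input: if $P_{i-1}$ terminates on input $n$ at step $s$, then $P_i$ terminates on input $n$ at step $s+1$ (with the same output), and if $P_{i-1}$ does not terminate on $n$, then neither does $P_i$. A constructive real number (CRN) is a pair of algorithms $(A,B)$, where $A$ transforms natural numbers into rational numbers and $B$ transforms natural numbers into natural numbers, such that for every integer $n>0$ and all $i,j\ge B(n)$ one has $|A(i)-A(j)|<2^{-n}$.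 If the CRN is denoted $x$, then $x(k)$ denotes $A(k)$; its value is the real number $\lim_k x(k)$, and equalities and inequalities between CRNs, and between expressions in them, refer to these values. Power mean: for positive reals $x_1,\dots,x_r$ and real $p\neq 0$, $M_p(x_1,\dots,x_r)=\left(\frac{x_1^p+\cdots+x_r^p}{r}\right)^{1/p}$, and $M_0(x_1,\dots,x_r)=\sqrt[r]{x_1\cdots x_r}$ (the geometric mean). Construction: for each natural $n$ and each $1\le i\le m$, $b_n^i$ is the CRN whose sequence of rationals is $b_n^i(k)=5+2^{-k}$ if $P_i$ has not yet finished working on input $n$ by step $k$, and $b_n^i(k)=5+2^{-l}$ if $P_i$ has finished working on $n$ by step $k$, where $l$ is the step number at which $P_i$ finished working. (These sequences converge in themselves at geometric speed, so they give CRNs.) *)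

(* Defs.v *)
From HB Require Import structures.
From mathcomp Require Import all_boot all_order all_algebra.
From mathcomp Require Import all_classical all_reals all_analysis.
From mathcomp Require Import ring lra zify.
Set Implicit Arguments.
Unset Strict Implicit.
Unset Printing Implicit Defensive.
Import Order.TTheory GRing.Theory Num.Theory.
Import numFieldNormedType.Exports.

Local Open Scope ring_scope.

(* Model of computation: WHILE programs over registers holding natural
   numbers, a Turing-complete language, with a small-step semantics in which
   every instruction, and every loop test, takes one step.  The input is read
   from register 0, all other registers being initially 0, and the output is
   left in register 0. *)
Inductive instr : Type :=
| Skip
| Inc of nat
| Dec of nat
| While of nat & seq instr.

Definition program := seq instr.

Definition store := nat -> nat.

(* The remaining instructions together with the contents of the registers. *)
Definition config := (program * store)%type.

Definition upd (s : store) (r v : nat) : store :=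
  fun x => if x == r then v else s x.

Definition step (c : config) : config :=
  let: (K, s) := c in
  match K with
  | [::] => c
  | Skip :: K' => (K', s)
  | Inc r :: K' => (K', upd s r (s r).+1)
  | Dec r :: K' => (K', upd s r (s r).-1)
  | While r body :: K' => if s r == 0%N then (K', s) else (body ++ K, s)
  end.

Definition init (n : nat) : store := upd (fun=> 0%N) 0 n.

Definition run (p : program) (n k : nat) : config := iter k step (p, init n).

Definition finished (p : program) (n k : nat) : bool := nilp (run p n k).1.

Definition output_at (p : program) (n k : nat) : nat := (run p n k).2 0%N.

Definition terminates_at (p : program) (n s y : nat) : Prop :=
  [/\ finished p n s, forall t, (t < s)%N -> ~~ finished p n t
    & output_at p n s = y].

Definition outputs (p : program) (n y : nat) : Prop :=
  exists s, terminates_at p n s y.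

Definition terminates (p : program) (n : nat) : Prop := exists y, outputs p n y.

Definition computable (f : nat -> nat) : Prop :=
  exists p : program, forall n, outputs p n (f n).

Definition zero_one_valued (p : program) : Prop :=
  forall n y, outputs p n y -> y = 0%N \/ y = 1%N.

Definition extendable (p : program) : Prop :=
  exists f : nat -> bool,
    computable f /\ forall n y, outputs p n y -> f n = y :> nat.

Definition one_step_late (p p' : program) : Prop :=
  forall n,
    (forall s y, terminates_at p n s y -> terminates_at p' n s.+1 y) /\
    (~ terminates p n -> ~ terminates p' n).

(* Sign, numerator and (predecessor of the) denominator are computable; the
   fraction need not be in lowest terms. *)
Definition computable_rat (a : nat -> rat) : Prop :=
  exists f g h : nat -> nat,
    [/\ computable f, computable g, computable h
      & forall k, a k = (-1) ^+ f k * (g k)%:R / (h k).+1%:R].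

Record CRN := MkCRN {
  crn_seq :> nat -> rat;
  crn_mod : nat -> nat;
  crn_seq_computable : computable_rat crn_seq;
  crn_mod_computable : computable crn_mod;
  crn_cauchy : forall n i j : nat, (0 < n)%N ->
    (crn_mod n <= i)%N -> (crn_mod n <= j)%N ->
    `|crn_seq i - crn_seq j| < 2 ^- n }.

Definition crn_val (R : realType) (x : CRN) : R :=
  limn (fun k => ratr (x k) : R).

Definition power_mean (R : realType) (r : nat) (p : R) (x : 'I_r -> R) : R :=
  if p == 0 then (\prod_i x i) `^ r%:R^-1
  else ((\sum_i x i `^ p) / r%:R) `^ p^-1.

(* The least step t <= k by which p has finished on n, when there is one. *)
Definition finish_step (p : program) (n k : nat) : nat :=
  find (finished p n) (iota 0 k.+1).

Definition b_seq (p : program) (n k : nat) : rat :=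
  if finished p n k then 5 + 2 ^- finish_step p n k else 5 + 2 ^- k.

(* The sequence [b_seq p n] is a CRN, with the identity as regulator. *)

Lemma finishedS p n k : finished p n k -> finished p n k.+1.
Proof.
rewrite /finished /run iterS; case: (iter k step _) => K s /=.
by case: K.
Qed.

Lemma finished_le p n k l : (k <= l)%N -> finished p n k -> finished p n l.
Proof.
by move=> /subnK <- h; elim: (l - k)%N => // d IH; rewrite addSn finishedS.
Qed.

Lemma finished_output p n k l : (k <= l)%N -> finished p n k ->
  run p n l = run p n k.
Proof.
move=> /subnK <-; rewrite /finished => h; elim: (l - k)%N => // d IH.
rewrite addSn /run iterS -/(run p n _) IH.
by rewrite -/(run p n k); case: (run p n k) h => [[|i K] s].
Qed.

Lemma outputs_finished p n k : finished p n k -> outputs p n (output_at p n k).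
Proof.
move=> hk; have ex : exists k, finished p n k by exists k.
case: (ex_minnP ex) => s hs hmin; exists s; split => //.
  by move=> t; rewrite ltnNge; apply: contra; exact: hmin.
by rewrite /output_at (finished_output (hmin _ hk)).
Qed.

Lemma b_seqE p n :
  (forall k, b_seq p n k = 5 + 2 ^- k) \/
  (exists l, forall k, b_seq p n k = 5 + 2 ^- minn k l).
Proof.
have [ex|nex] := pselect (exists k, finished p n k); last first.
  by left => k; rewrite /b_seq; case: ifPn => // h; case: nex; exists k.
right; case: (ex_minnP ex) => l hl hmin; exists l => k; rewrite /b_seq.
case: ifPn => [hk|nhk].
  congr (5 + 2 ^- _); have lek := hmin _ hk.
  rewrite (minn_idPr lek) /finish_step.
  have hh : has (finished p n) (iota 0 k.+1).
    by apply/hasP; exists l => //; rewrite mem_iota add0n ltnS lek.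
  have hf := nth_find 0%N hh; move: hh; rewrite has_find size_iota => hlt.
  move: hf; rewrite nth_iota // add0n => /hmin le1.
  apply/eqP; rewrite eqn_leq le1 andbT leqNgt; apply/negP => hlt'.
  have := before_find 0%N hlt'; rewrite nth_iota ?add0n ?hl //.
suff /ltnW /minn_idPl -> : (k < l)%N by [].
by rewrite ltnNge; apply: contra nhk => lek; apply: finished_le hl.
Qed.

Definition exec (p : program) (s s' : store) : Prop :=
  forall K, exists t, iter t step (p ++ K, s) = (K, s').

Lemma exec_nil s : exec [::] s s. Proof. by move=> K; exists 0%N. Qed.

Lemma exec_cat p q s1 s2 s3 : exec p s1 s2 -> exec q s2 s3 ->
  exec (p ++ q) s1 s3.
Proof.
move=> h1 h2 K; have [t1 e1] := h1 (q ++ K); have [t2 e2] := h2 K.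
by exists (t2 + t1)%N; rewrite iterD -catA e1 e2.
Qed.

Lemma exec_cons i q s1 s2 s3 : exec [:: i] s1 s2 -> exec q s2 s3 ->
  exec (i :: q) s1 s3.
Proof. exact: (@exec_cat [:: i]). Qed.

Lemma exec_inc r s : exec [:: Inc r] s (upd s r (s r).+1).
Proof. by move=> K; exists 1%N. Qed.

Lemma exec_dec r s : exec [:: Dec r] s (upd s r (s r).-1).
Proof. by move=> K; exists 1%N. Qed.

Lemma exec_computes p n s' : exec p (init n) s' -> outputs p n (s' 0%N).
Proof.
move=> /(_ [::]) [t]; rewrite cats0 => e.
have -> : s' 0%N = output_at p n t by rewrite /output_at /run e.
by apply: outputs_finished; rewrite /finished /run e.
Qed.

(* Adds c times register x to register y, and clears register x. *)
Definition transfer c x y := While x (Dec x :: nseq c (Inc y)).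

Lemma exec_incs c y s : exec (nseq c (Inc y)) s (upd s y (s y + c)%N).
Proof.
elim: c s => [|c IH] s.
  rewrite addn0 (_ : upd _ _ _ = s); first exact: exec_nil.
  by apply/funext => z; rewrite /upd; case: eqP => [->|].
apply: exec_cons (exec_inc _ _) _.
rewrite (_ : upd s y (s y + c.+1)%N =
  upd (upd s y (s y).+1) y (upd s y (s y).+1 y + c)%N).
  exact: IH.
by apply/funext => z; rewrite /upd eqxx; case: eqP => // _; rewrite addnS.
Qed.

Lemma exec_transfer c x y s : x != y ->
  exec [:: transfer c x y] s (upd (upd s x 0%N) y (s y + c * s x)%N).
Proof.
move=> nxy; move: {2}(s x) (erefl (s x)) => j.
elim: j s => [|j IH] s hx K.
  exists 1%N; rewrite /= hx /=; congr (_, _); apply/funext => z.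
  rewrite /upd muln0 addn0; case: eqP => [->//|_]; case: eqP => // ->.
  by rewrite hx.
pose s1 := upd s x (s x).-1; pose s2 := upd s1 y (s1 y + c)%N.
have e1 : exec (Dec x :: nseq c (Inc y)) s s2.
  by apply: exec_cons (exec_dec _ _) _; apply: exec_incs.
have hx2 : s2 x = j by rewrite /s2 /s1 /upd (negbTE nxy) eqxx hx.
have [t1 {}e1] := e1 (transfer c x y :: K).
have [t2 e2] := IH s2 hx2 K.
exists (t2 + (t1 + 1))%N; rewrite !iterD /= hx /=.
move: e1 e2; rewrite /= /transfer => -> ->.
congr (_, _); apply/funext => z.
rewrite /s2 /s1 /upd; case: (eqVneq z y) => [_|_].
  by rewrite !eqxx eq_sym (negbTE nxy) hx; lia.
by case: eqP.
Qed.


Lemma exec_sub x y s : x != y ->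
  exec [:: While x [:: Dec x; Dec y]] s (upd (upd s x 0%N) y (s y - s x)%N).
Proof.
move=> nxy; move: {2}(s x) (erefl (s x)) => j.
elim: j s => [|j IH] s hx K.
  exists 1%N; rewrite /= hx /=; congr (_, _); apply/funext => z.
  rewrite /upd subn0; case: eqP => [->//|_]; case: eqP => // ->.
  by rewrite hx.
pose s1 := upd s x (s x).-1; pose s2 := upd s1 y (s1 y).-1.
have hx2 : s2 x = j by rewrite /s2 /s1 /upd (negbTE nxy) eqxx hx.
have [t2 e2] := IH s2 hx2 K.
exists (t2 + 3)%N; rewrite iterD /= hx /= e2.
congr (_, _); apply/funext => z.
rewrite /s2 /s1 /upd; case: (eqVneq z y) => [_|_].
  by rewrite !eqxx eq_sym (negbTE nxy) hx; lia.
by case: eqP.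
Qed.

(* Register 0 becomes min(k, l), k being its initial value. *)
Definition min_prog (l : nat) : program :=
  nseq l (Inc 1) ++ While 0 [:: Dec 0; Dec 1] :: nseq l (Inc 0)
    ++ [:: While 1 [:: Dec 1; Dec 0]].

Lemma exec_eq p s s1 s2 : exec p s s1 -> s1 =1 s2 -> exec p s s2.
Proof. by move=> h /funext <-. Qed.

Lemma exec_min l k : exec (min_prog l) (init k) (init (minn k l)).
Proof.
have h1 := @exec_incs l 1 (init k).
have h2 := exec_cons (@exec_sub 0 1 _ isT)
  (exec_cat (@exec_incs l 0 _) (@exec_sub 1 0 _ isT)).
apply: exec_eq (exec_cat h1 (h2 _)) _ => -[|[|z]] //.
by rewrite /upd /init /upd /= minnE; lia.
Qed.

(* Register 3 becomes 2 ^ k and register 0 is cleared, k being the initial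
   value of register 0. *)
Definition pow_prog : program :=
  [:: Inc 3; While 0 [:: Dec 0; transfer 2 3 4; transfer 1 4 3]].

Lemma exec_pow k : exec pow_prog (init k) (upd (init 0) 3 (2 ^ k)%N).
Proof.
pose body := [:: Dec 0; transfer 2 3 4; transfer 1 4 3].
have loop : forall j s, s 0%N = j -> s 4%N = 0%N -> exec [:: While 0 body] s
    (upd (upd s 0 0%N) 3 (s 3 * 2 ^ j)%N).
  elim=> [|j IH] s s0 s4 K.
    exists 1%N; rewrite /= s0 /=; congr (_, _); apply/funext => z.
    rewrite /upd muln1; case: eqP => [->//|_]; case: eqP => // ->.
    by rewrite s0.
  have e1 := exec_cons (exec_dec 0 s) (exec_cons
    (@exec_transfer 2 3 4 _ isT) (@exec_transfer 1 4 3 _ isT)).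
  set s2 := upd _ _ _ in e1.
  have [t1 {}e1] := e1 (While 0 body :: K).
  have [|//|t2 e2] := IH s2 _ _ K; first by rewrite /s2 /upd /= s0.
  exists (t2 + (t1 + 1))%N; rewrite !iterD [iter 1 _ _]/= s0 e1 e2.
  congr (_, _); apply/funext => -[|[|[|[|[|z]]]]] //=.
  by rewrite /s2 /upd /= s4 expnS !add0n mul1n mulnCA mulnA.
apply: exec_eq (exec_cons (exec_inc _ _) (loop k _ _ _)) _ => //.
by move=> -[|[|[|[|z]]]] //; rewrite /upd /= mul1n.
Qed.

(* Numerator and denominator (minus one) of 5 + 2 ^- f k. *)
Lemma computable_num (f : nat -> nat) (p : program) :
  (forall k, exec p (init k) (init (f k))) ->
  computable (fun k => 5 * 2 ^ f k + 1)%N /\ computable (fun k => (2 ^ f k).-1)%N.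
Proof.
move=> hp; split.
  exists (p ++ pow_prog ++ [:: transfer 5 3 0; Inc 0]) => k.
  have e := exec_cat (hp k) (exec_cat (exec_pow _)
    (exec_cons (@exec_transfer 5 3 0 _ isT) (exec_inc 0 _))).
  by move/exec_computes: e; rewrite /upd /= addn1.
exists (p ++ pow_prog ++ [:: transfer 1 3 0; Dec 0]) => k.
have e := exec_cat (hp k) (exec_cat (exec_pow _)
  (exec_cons (@exec_transfer 1 3 0 _ isT) (exec_dec 0 _))).
by move/exec_computes: e; rewrite /upd /= add0n mul1n.
Qed.

Lemma computable_zero : computable (fun=> 0%N).
Proof.
exists [:: transfer 0 0 1] => k.
exact: exec_computes (@exec_transfer 0 0 1 (init k) isT).
Qed.

Lemma computable_id : computable id.
Proof. by exists [::] => k; apply: exec_computes (exec_nil _). Qed.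

Lemma computable_rat_b (f : nat -> nat) (p : program) :
  (forall k, exec p (init k) (init (f k))) ->
  computable_rat (fun k => 5 + 2 ^- f k).
Proof.
move=> /computable_num[cn cd].
exists (fun=> 0%N), (fun k => 5 * 2 ^ f k + 1)%N, (fun k => (2 ^ f k).-1)%N.
split => // [|k]; first exact: computable_zero.
rewrite prednK ?expn_gt0 // expr0 mul1r natrD natrM natrX.
by field; rewrite expf_neq0.
Qed.

Lemma b_seq_computable p n : computable_rat (b_seq p n).
Proof.
have [e|[l e]] := b_seqE p n; rewrite (funext e).
  by apply: (@computable_rat_b id [::]) => k; apply: exec_nil.
by apply: (@computable_rat_b (fun k => minn k l)) => k; apply: exec_min.
Qed.

Lemma b_seq_cauchy p n (N i j : nat) : (0 < N)%N -> (N <= i)%N -> (N <= j)%N ->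
  `|b_seq p n i - b_seq p n j| < 2 ^- N.
Proof.
move=> N0 Ni Nj; have half a b : (a <= b)%N -> (2 : rat) ^- b <= 2 ^- a.
  by move=> ab; rewrite lef_pV2 ?posrE ?exprn_gt0 // ler_eXn2l.
have pos a : 0 < (2 : rat) ^- a by rewrite invr_gt0 exprn_gt0.
have main a b : (N <= a)%N -> (N <= b)%N ->
    `|5 + 2 ^- a - (5 + 2 ^- b)| < (2 : rat) ^- N.
  move=> /half ha /half hb; rewrite ltr_norml; apply/andP.
  by have := pos a; have := pos b; split; lra.
have [e|[l e]] := b_seqE p n; rewrite !e; first exact: main.
have [lN|Nl] := leqP l N; last by apply: main; rewrite leq_min ?Ni ?Nj ltnW.
rewrite !(minn_idPr _) ?(leq_trans lN) // subrr normr0; exact: pos.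
Qed.

Definition b_crn (p : program) (n : nat) : CRN :=
  @MkCRN (b_seq p n) id (b_seq_computable p n) computable_id (b_seq_cauchy p n).

Lemma one_step_late_Skip p : one_step_late p (Skip :: p).
Proof.
have runS n k : run (Skip :: p) n k.+1 = run p n k by rewrite /run iterSr.
move=> n; split=> [s y [h1 h2 h3]|nt [y [[|s] [h1 h2 h3]]]].
- by split=> [|[|t] //|]; rewrite /finished /output_at runS // ltnS; apply: h2.
- by [].
apply: nt; exists (output_at p n s); apply: outputs_finished.
by move: h1; rewrite /finished runS.
Qed.

(* Main.v *)
(* Power means are strictly increasing in the exponent as
   soon as two of the values differ.  If P_1 does not halt on n, all the b_n^i
   are 5 and both means are 5; if it halts at step s, then b_n^1 = 5 + 2^-s and
   b_n^2 = 5 + 2^-(s+1) differ and the inequality is strict.  A procedure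
   separating the two cases would therefore decide whether P_1 halts on n, and
   running P_1 only where it halts (answering 0 elsewhere) would extend it to a
   total algorithm. *)

Require Import Defs.
From mathcomp Require Import all_boot all_order all_algebra.
From mathcomp Require Import all_classical all_reals all_analysis.
From mathcomp Require Import ring lra zify.
Set Implicit Arguments.
Unset Strict Implicit.
Unset Printing Implicit Defensive.
Import Order.TTheory GRing.Theory Num.Theory.
Import numFieldNormedType.Exports.
Local Open Scope ring_scope.

(** * Composition of programs *)

Fixpoint rename_instr (f : nat -> nat) (i : instr) : instr :=
  match i with
  | Skip => Skip
  | Inc r => Inc (f r)
  | Dec r => Dec (f r)
  | While r body => While (f r) (map (rename_instr f) body)
  end.

Definition rename (f : nat -> nat) (p : program) : program :=
  map (rename_instr f) p.

Lemma rename_cat f p p' : rename f (p ++ p') = rename f p ++ rename f p'.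
Proof. exact: map_cat. Qed.

(** An empty [K] idles on its own, while [K ++ L] would already start on [L]; hence the guard. *)
Lemma step_cat K L s : ~~ nilp K ->
  step (K ++ L, s) = ((step (K, s)).1 ++ L, (step (K, s)).2).
Proof.
case: K => [//|[|r|r|r body] K _] //=.
by case: ifP => //= _; rewrite -catA.
Qed.

(** A halting run can be replayed in front of any continuation, once the idle steps after halting
    are dropped. *)
Lemma run_exec p s t s' : iter t step (p, s) = ([::], s') -> exec p s s'.
Proof.
move=> e L; elim: t p s e => [|t IH] p s; first by case=> -> ->; exists 0%N.
rewrite iterSr; case: (boolP (nilp p)) => [/nilP -> /IH //|pn].
case E : (step (p, s)) => [K s1] /IH [u eu]; exists u.+1.
by rewrite iterSr step_cat // E.
Qed.

Lemma outputs_exec p n y : outputs p n y ->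
  exists2 s, exec p (init n) s & s 0%N = y.
Proof.
case=> t [fin _ <-]; exists (run p n t).2 => //; apply: (@run_exec _ _ t).
by move: fin; rewrite /finished /run; case: (iter _ _ _) => K s /= /nilP ->.
Qed.

Lemma step_rename f K s u : injective f -> u \o f =1 s ->
  exists u', [/\ step (rename f K, u) = (rename f (step (K, s)).1, u'),
    u' \o f =1 (step (K, s)).2 & forall x, (forall r, x != f r) -> u' x = u x].
Proof.
move=> finj us.
have upd_f r v : upd u (f r) v \o f =1 upd s r v.
  by move=> x; rewrite /upd /= (inj_eq finj); case: eqP => // _; exact: us.
have upd_out r v x : (forall r, x != f r) -> upd u (f r) v x = u x.
  by move=> /(_ r) /negbTE h; rewrite /upd h.
case: K => [|[|r|r|r body] K] /=; try by exists u.
- exists (upd u (f r) (u (f r)).+1); split=> // [x|x]; last exact: upd_out.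
  by have /= -> := us r; apply: upd_f.
- exists (upd u (f r) (u (f r)).-1); split=> // [x|x]; last exact: upd_out.
  by have /= -> := us r; apply: upd_f.
- exists u; have /= -> := us r; case: ifP => // _; split=> //=.
  by rewrite rename_cat.
Qed.

(** This lets a program run in private registers: data stored outside the image of [f] survives. *)
Lemma exec_rename f p s s' u : injective f -> exec p s s' -> u \o f =1 s ->
  exists u', [/\ exec (rename f p) u u', u' \o f =1 s'
    & forall x, (forall r, x != f r) -> u' x = u x].
Proof.
move=> finj /(_ [::]) [t]; rewrite cats0 => e us.
suff [u' [eu' us' out]] : exists u', [/\
    iter t step (rename f p, u) = (rename f [::], u'), u' \o f =1 s'
    & forall x, (forall r, x != f r) -> u' x = u x].
  by exists u'; split=> //; apply: run_exec eu'.
elim: t p s u us e => [|t IH] p s u us.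
  by case=> -> es; exists u; split=> // x; rewrite -es; apply: us.
rewrite iterSr; case E : (step (p, s)) => [K s1] e.
have [u1 [e1 us1 out1]] := step_rename p finj us.
rewrite E in e1 us1; have [u' [e' us' out']] := IH _ _ _ us1 e.
exists u'; rewrite iterSr e1; split=> // x hx.
by rewrite out' // out1.
Qed.

(* Register 2 is only a temporary and is cleared again. *)
Definition copy_prog : program :=
  [:: While 0 [:: Dec 0; Inc 3; Inc 2]; transfer 1 2 0].

Lemma exec_copy n : exec copy_prog (init n) (upd (init n) 3 n).
Proof.
have loop j : forall s, s 0%N = j -> exec [:: While 0 [:: Dec 0; Inc 3; Inc 2]] s
    (upd (upd (upd s 0 0%N) 3 (s 3 + j)%N) 2 (s 2 + j)%N).
  elim: j => [|j IH] s s0 K.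
    exists 1%N; rewrite /= s0 /=; congr (_, _); apply/funext.
    by move=> [|[|[|[|x]]]]; rewrite /upd /= ?addn0.
  have [|t e] := IH (upd (upd (upd s 0 j) 3 (s 3).+1) 2 (s 2).+1) _ K; first by [].
  exists (t + 4)%N; rewrite iterD /= s0 /=.
  set s2 := upd _ 2 _; rewrite (_ : s2 = upd (upd (upd s 0 j) 3 (s 3).+1) 2 (s 2).+1).
    rewrite e; congr (_, _); apply/funext.
    by move=> [|[|[|[|x]]]]; rewrite /upd //= addnS.
  by apply/funext => -[|[|[|[|x]]]]; rewrite /s2 /upd /= ?s0.
apply: exec_eq (exec_cons (loop n _ _) (@exec_transfer 1 2 0 _ isT)) _ => //.
by move=> [|[|[|[|x]]]]; rewrite /upd /= ?mul1n.
Qed.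

Definition double (r : nat) := (2 * r)%N.
Definition double3 (r : nat) := (2 * r + 3)%N.

(* The registers of D are moved to the even numbers, those of p to the odd
   numbers from 3 on, so that the copy of the input in register 3 survives the
   run of D; register 1 collects the result. *)
Definition guarded_prog (D p : program) : program :=
  copy_prog ++ rename double D ++
    [:: While 0 (Dec 0 :: rename double3 p ++ [:: transfer 1 3 1]);
        transfer 1 1 0].

(** [D] touches only even registers, so the odd ones from 3 on still form a fresh initial store for
    [p] when the verdict is tested. *)
Lemma exec_copy_rename D n d :
  outputs D n d -> exists s, [/\ exec (copy_prog ++ rename double D) (init n) s,
    s 0%N = d, s 1%N = 0%N & s \o double3 =1 init n].
Proof.
move=> /outputs_exec [s1 e1 <-].
have inj2 : injective double by rewrite /double => x y; lia.
have [|u [eu u2 out]] := @exec_rename _ _ _ _ (upd (init n) 3 n) inj2 e1.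
  by move=> [|x]; rewrite /double /= /init /upd //=; case: eqP => //; lia.
exists u; split; [exact: exec_cat (exec_copy n) eu | exact: (u2 0%N) | |].
  by rewrite out // => r; apply/eqP; rewrite /double; lia.
move=> r /=; rewrite out => [|k]; last first.
  by apply/eqP; rewrite /double /double3; lia.
by case: r => [|r]; rewrite /init /upd /double3 //= ifF ?ifF //; lia.

Qed.

(** Verdict 0 skips the loop, so [p] is never started and may diverge harmlessly. *)
Lemma guarded_prog0 D p n : outputs D n 0 -> outputs (guarded_prog D p) n 0.
Proof.
move=> /exec_copy_rename [s [es s0 s1 _]].
have ew : exec [:: While 0 (Dec 0 :: rename double3 p ++ [:: transfer 1 3 1])] s s.
  by move=> K; exists 1%N; rewrite /= s0.
have := exec_cat es (exec_cons ew (@exec_transfer 1 1 0 s isT)).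
rewrite -catA => /exec_computes.
by rewrite /upd /= s0 s1.
Qed.

(** Verdict 1 runs the loop body exactly once: [Dec 0] clears the guard, and the renamed [p] cannot
    reach registers 0 to 2. *)
Lemma guarded_prog1 D p n y : outputs D n 1 -> outputs p n y ->
  outputs (guarded_prog D p) n y.
Proof.
move=> /exec_copy_rename [s [es s0 s1 s3]] /outputs_exec [s' e' <-].
have inj3 : injective double3 by rewrite /double3 => a b; lia.
have [|u [eu u3 out]] := @exec_rename _ _ _ _ (upd s 0 0%N) inj3 e'.
  by move=> r; rewrite -(s3 r) /= /upd; case: eqP => //; rewrite /double3; lia.
have lt3 x : (x < 3)%N -> forall r, x != double3 r.
  by move=> x3 r; apply/eqP; rewrite /double3; lia.
have u0 : u 0%N = 0%N by rewrite out; [|exact: lt3].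
have u1 : u 1%N = 0%N by rewrite out; [rewrite /upd /= s1|exact: lt3].
have eu3 : u 3%N = s' 0%N := u3 0%N.
have eb : exec (Dec 0 :: rename double3 p ++ [:: transfer 1 3 1]) s
    (upd (upd u 3 0%N) 1 (s' 0%N)).
  apply: exec_cons (exec_dec _ _) _; rewrite s0 /=.
  by apply: exec_eq (exec_cat eu (@exec_transfer 1 3 1 _ isT)) _ => x;
    rewrite u1 eu3 mul1n.
set v := upd _ 1 _ in eb.
have ew : exec [:: While 0 (Dec 0 :: rename double3 p ++ [:: transfer 1 3 1])] s v.
  move=> K; have [t et] := eb (While 0
    (Dec 0 :: rename double3 p ++ [:: transfer 1 3 1]) :: K).
  (* One step to enter the loop, [t] for the body, one for the test that leaves it. *)
  exists (1 + (t + 1))%N; rewrite !iterD [iter 1 _ (_ ++ _, _)]/= s0 et /=.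
  by rewrite /v /upd /= u0.
have := exec_cat es (exec_cons ew (@exec_transfer 1 1 0 _ isT)).
rewrite -catA => /exec_computes.
by rewrite /v /upd /= u0 mul1n.
Qed.

(** * From a halting test to a total extension *)

Lemma halting_undecidable (p : program) : zero_one_valued p -> ~ extendable p ->
  ~ exists D : program, forall n, exists2 d, outputs D n d &
      (d = 0%N /\ ~ terminates p n) \/ (d = 1%N /\ terminates p n).
Proof.
move=> p01 next [D hD]; apply: next.
have det n y y' : outputs p n y -> outputs p n y' -> y = y'.
  move=> [s [fs ms <-]] [s' [fs' ms' <-]].
  have [lt|lt|->//] := ltngtP s s'; first by have := ms' _ lt; rewrite fs.
  by have := ms _ lt; rewrite fs'.
(* This total function is 0 both where [p] outputs 0 and where it diverges, which is what
   [guarded_prog D p] computes. *)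
exists (fun n => `[< outputs p n 1 >]); split.
  exists (guarded_prog D p) => n; case: (hD n) => d Dd [[d0 nt]|[d1 [y py]]].
    rewrite d0 in Dd; rewrite asboolF /=; first exact: guarded_prog0.
    by move=> h; apply: nt; exists 1%N.
  rewrite d1 in Dd; have := guarded_prog1 Dd py.
  case: (p01 _ _ py) => e; rewrite e in py *; last by rewrite asboolT.
  by rewrite asboolF // => /(det _ _ _ py).
move=> n y py; case: (p01 _ _ py) => e; rewrite e in py *; last by rewrite asboolT.
by rewrite asboolF // => /(det _ _ _ py).
Qed.

(** * Strict monotonicity of power means *)

Lemma ltr_sum_exists (R : realType) (r : nat) (f g : 'I_r -> R) (i0 : 'I_r) :
  (forall i, f i <= g i) -> f i0 < g i0 -> \sum_i f i < \sum_i g i.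
Proof.
move=> fg lt0; rewrite (bigD1 i0) //= [ltRHS](bigD1 i0) //=.
by rewrite ltr_leD // ler_sum.
Qed.

(* Bernoulli's inequality [1 + a (y - 1) < y `^ a] at [y = expR z]. *)
Lemma expR_bernoulli (R : realType) (a z : R) : 1 < a -> z != 0 ->
  1 + a * (expR z - 1) < expR (a * z).
Proof.
move=> a1 z0.
have -> : a * z = z + (a - 1) * z by ring.
have h1 := expR_ge1Dx ((a - 1) * z).
have h2 : 1 + - z < expR (- z) by rewrite expR_gt1Dx // oppr_eq0.
have ez := expR_gt0 z.
have h3 : expR z * (1 - z) < 1.
  by rewrite -[ltRHS](expRxMexpNx_1 z) ltr_pM2l.
rewrite expRD; apply: (@lt_le_trans _ _ (expR z * (1 + (a - 1) * z))).
  (* The right side minus the left is [(a - 1) * (1 - expR z * (1 - z))], positive by [h3]. *)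
  by nra.
by rewrite ler_pM2l.
Qed.

(* Logarithm of the power mean of the [expR (u i)]. *)
Definition log_mean (R : realType) (r : nat) (t : R) (u : 'I_r -> R) : R :=
  if t == 0 then (\sum_i u i) / r%:R
  else ln ((\sum_i expR (t * u i)) / r%:R) / t.

Lemma power_meanE (R : realType) (r : nat) (t : R) (x : 'I_r -> R) :
  (0 < r)%N -> (forall i, 0 < x i) ->
  power_mean t x = expR (log_mean t (fun i => ln (x i))).
Proof.
move=> r0 x0; rewrite /power_mean /log_mean.
have r0' : 0 < r%:R :> R by rewrite ltr0n.
case: ifPn => t0.
  have -> : \prod_i x i = expR (\sum_i ln (x i)).
    by rewrite expR_sum; apply: eq_bigr => i _; rewrite lnK ?posrE.
  (* [powR] treats base 0 separately; positivity selects its exponential branch. *)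
  by rewrite /powR gt_eqF ?expR_gt0 // expRK mulrC.
have -> : \sum_i x i `^ t = \sum_i expR (t * ln (x i)).
  by apply: eq_bigr => i _; rewrite /powR gt_eqF.
have s0 : 0 < \sum_i expR (t * ln (x i)).
  by rewrite (bigD1 (Ordinal r0)) //= ltr_pwDl ?expR_gt0 // sumr_ge0 // => i _;
    exact: expR_ge0.
by rewrite /powR gt_eqF ?divr_gt0 // mulrC.
Qed.


Section LogMean.
Variables (R : realType) (r : nat).
Hypothesis r_gt0 : (0 < r)%N.
Implicit Types (t c : R) (u : 'I_r -> R).

Let rR_gt0 : 0 < r%:R :> R. Proof. by rewrite ltr0n. Qed.

Let mean_gt0 t u : 0 < (\sum_i expR (t * u i)) / r%:R.
Proof.
rewrite divr_gt0 // (bigD1 (Ordinal r_gt0)) //= ltr_pwDl ?expR_gt0 //.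
by rewrite sumr_ge0 // => i _; exact: expR_ge0.
Qed.

Lemma log_mean_cst t c : log_mean t (fun=> c : R) (r := r) = c.
Proof.
rewrite /log_mean; case: ifPn => t0; rewrite sumr_const card_ord -[_ *+ r]mulr_natr.
  by rewrite mulfK // gt_eqF.
by rewrite mulfK ?gt_eqF // expRK mulrAC mulfV // mul1r.
Qed.

(** Inverting all the values inverts the mean and flips the exponent; this reduces negative
    exponents to positive ones. *)
Lemma log_meanN t u : log_mean (- t) (fun i => - u i) = - log_mean t u.
Proof.
rewrite /log_mean oppr_eq0; case: ifPn => t0; first by rewrite sumrN mulNr.
by under eq_bigr do rewrite mulrNN; rewrite invrN mulrN.
Qed.

Lemma sum_expR_shift t u c :
  \sum_i expR (t * (u i - c)) = (\sum_i expR (t * u i)) / expR (t * c).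
Proof.
by rewrite mulr_suml; apply: eq_bigr => i _; rewrite mulrBr expRD expRN.
Qed.

Lemma lt_log_mean t u c : 0 < t ->
  (c < log_mean t u) = (r%:R < \sum_i expR (t * (u i - c))).
Proof.
move=> t0; rewrite /log_mean gt_eqF // ltr_pdivlMr // -ltr_expR lnK ?posrE //.
by rewrite ltr_pdivlMr // sum_expR_shift ltr_pdivlMr ?expR_gt0 // mulrC (mulrC c).
Qed.

Lemma sum_expR_log_mean t u : t != 0 ->
  \sum_i expR (t * (u i - log_mean t u)) = r%:R.
Proof.
move=> t0; rewrite sum_expR_shift /log_mean (negbTE t0) mulrCA mulfV // mulr1.
have := mean_gt0 t u; set S := \sum_i _ => S0; rewrite lnK ?posrE //.
have S1 : S != 0 by apply: contraTneq S0 => ->; rewrite mul0r ltxx.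
by rewrite invf_div mulrCA mulfV // mulr1.
Qed.

(** Centre [u] at [c], its mean of exponent [t]. Each [expR (t' * (u l - c))] is bounded below by a
    Bernoulli term with exponent [t' / t], or by its tangent at 0 if [t = 0]; these bounds sum to
    [r], and one is strict because [u] is not constantly [c]. *)
Lemma log_mean_lt_pos t t' u i j : 0 <= t -> t < t' -> u i != u j ->
  log_mean t u < log_mean t' u.
Proof.
move=> t0 tt' nij; have t'0 := le_lt_trans t0 tt'.
rewrite lt_log_mean //; set c := log_mean t u.
have [k nk] : exists k, u k != c.
  by have [e|] := eqVneq (u i) c; [exists j; rewrite -e eq_sym | exists i].
case: (eqVneq t 0) => [t00|t_neq0].
  have <- : \sum_i (1 + t' * (u i - c)) = r%:R.
    rewrite big_split /= -mulr_sumr sumrB !sumr_const card_ord.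
    rewrite /c /log_mean t00 eqxx -[(_ / _) *+ r]mulr_natr mulfVK ?gt_eqF //.
    by rewrite subrr mulr0 addr0.
  apply: (@ltr_sum_exists _ _ _ _ k) => [l|]; first exact: expR_ge1Dx.
  by rewrite expR_gt1Dx // mulf_neq0 ?subr_eq0 // gt_eqF.
have t_gt0 : 0 < t by rewrite lt_def t_neq0.
pose a := t' / t; have a1 : 1 < a by rewrite ltr_pdivlMr // mul1r.
have <- : \sum_i (1 + a * (expR (t * (u i - c)) - 1)) = r%:R.
  rewrite big_split /= -mulr_sumr sumrB !sumr_const card_ord.
  by rewrite sum_expR_log_mean // subrr mulr0 addr0.
have aE l : t' * (u l - c) = a * (t * (u l - c)).
  by rewrite /a mulrA mulfVK.
apply: (@ltr_sum_exists _ _ _ _ k) => [l|]; rewrite aE.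
  have [->|nl] := eqVneq (t * (u l - c)) 0; last exact/ltW/expR_bernoulli.
  by rewrite mulr0 expR0 subrr mulr0 addr0.
by apply: expR_bernoulli => //; rewrite mulf_neq0 // subr_eq0.
Qed.

(** Reflection by [log_meanN] handles nonpositive exponents; exponents of opposite signs are
    compared through 0. *)
Lemma log_mean_lt t t' u i j : t < t' -> u i != u j ->
  log_mean t u < log_mean t' u.
Proof.
have neg (s s' : R) (v : 'I_r -> R) k l : s' <= 0 -> s < s' -> v k != v l ->
    log_mean s v < log_mean s' v.
  move=> s'0 ss' nkl.
  have := @log_mean_lt_pos (- s') (- s) (fun i => - v i) k l.
  by rewrite !log_meanN oppr_ge0 eqr_opp !ltrN2; apply.
move=> tt' nij; have [t0|t0] := leP 0 t; first exact: log_mean_lt_pos nij.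
have [t'0|t'0] := leP t' 0; first exact: neg nij.
exact: lt_trans (neg _ _ _ _ _ (lexx 0) t0 nij)
  (log_mean_lt_pos (lexx 0) t'0 nij).
Qed.

Lemma power_mean_lt t t' (x : 'I_r -> R) i j : (forall i, 0 < x i) ->
  t < t' -> x i != x j -> power_mean t x < power_mean t' x.
Proof.
move=> x0 tt' nij; rewrite !power_meanE // ltr_expR.
apply: (@log_mean_lt _ _ _ i j) => //; apply: contra nij => /eqP /ln_inj ->;
  by rewrite ?posrE.
Qed.

Lemma power_mean_cst t c : 0 < c -> power_mean t (fun=> c : R) (r := r) = c.
Proof. by move=> c0; rewrite power_meanE // log_mean_cst lnK ?posrE. Qed.

End LogMean.

(** * Values of the constructive reals b_n^i *)

Lemma crn_val_near_cst (R : realType) (x : CRN) (c : rat) (N : nat) :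
  (forall k, (N <= k)%N -> x k = c) -> crn_val R x = ratr c.
Proof.
move=> h; apply/cvg_lim => //; apply: cvg_near_cst.
by exists N => // k /= Nk; rewrite h.
Qed.

Lemma crn_val_b_nonterm (R : realType) p n : ~ terminates p n ->
  crn_val R (b_crn p n) = 5.
Proof.
move=> nt; have nf k : finished p n k = false.
  by apply/negP => f; apply: nt; exists (output_at p n k); exact: outputs_finished.
rewrite /crn_val; apply: cvg_lim => //=.
have -> : (fun k => ratr (b_seq p n k)) = (fun k => 5 + (2^-1) ^+ k : R).
  by apply/funext => k; rewrite /b_seq nf rmorphD /= fmorphV rmorphXn /= !ratr_nat exprVn.
rewrite -[X in (_ --> X)%classic]addr0.
apply: cvgD; first exact: cvg_cst.
by apply: cvg_expr; rewrite ger0_norm ?invr_ge0 // invf_lt1 // ltr1n.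
Qed.

Lemma crn_val_b_term (R : realType) p n s y : terminates_at p n s y ->
  crn_val R (b_crn p n) = 5 + 2 ^- s.
Proof.
move=> [fs ms _].
rewrite (@crn_val_near_cst _ _ (5 + 2 ^- s) s) => [|k sk].
  by rewrite rmorphD /= fmorphV rmorphXn /= !ratr_nat.
rewrite /= /b_seq (finished_le sk fs); congr (5 + 2 ^- _).
rewrite /finish_step.
have hk : has (finished p n) (iota 0 k.+1).
  by apply/hasP; exists s => //; rewrite mem_iota add0n ltnS sk.
(* The search cannot pass [s], where [p] has finished, nor stop earlier, by minimality of [s]. *)
apply/eqP; rewrite eqn_leq; apply/andP; split; rewrite leqNgt; apply/negP => lt.
  by have := before_find 0%N lt; rewrite nth_iota ?add0n ?fs.
have := nth_find 0%N hk; rewrite nth_iota ?add0n; last first.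
  by move: hk; rewrite has_find size_iota.
by rewrite (negbTE (ms _ lt)).
Qed.

(** The delays add up. Programs are numbered from 1 and ordinals from 0, so [P i.+1] is late by
    [i]. *)
Lemma late_terminates_at (P : nat -> program) m n s y i :
  (forall i, (2 <= i <= m)%N -> one_step_late (P i.-1) (P i)) ->
  terminates_at (P 1%N) n s y -> (i < m)%N -> terminates_at (P i.+1) n (s + i)%N y.
Proof.
move=> late t1; elim: i => [|i IH] im; first by rewrite addn0.
by rewrite addnS; have [+ _] := late i.+2 im n; apply; apply/IH/ltnW.
Qed.

Lemma late_not_terminates (P : nat -> program) m n i :
  (forall i, (2 <= i <= m)%N -> one_step_late (P i.-1) (P i)) ->
  ~ terminates (P 1%N) n -> (i < m)%N -> ~ terminates (P i.+1) n.
Proof.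
move=> late t1; elim: i => [//|i IH] im.
by have [_] := late i.+2 im n; apply; apply/IH/ltnW.
Qed.

Theorem theorem8 (R : realType) (m : nat) (P : nat -> program) (p q : rat) :
  (3 <= m)%N ->
  zero_one_valued (P 1%N) ->
  ~ extendable (P 1%N) ->
  (forall i : nat, (2 <= i <= m)%N -> one_step_late (P i.-1) (P i)) ->
  p < q ->
  let M (r : rat) (n : nat) : R :=
    power_mean (ratr r) (fun i : 'I_m => crn_val R (b_crn (P i.+1) n)) in
  ~ exists D : program, forall n : nat, exists2 d : nat, outputs D n d &
      (d = 0%N /\ M p n = M q n) \/ (d = 1%N /\ M p n < M q n).
Proof.
move=> m3 P01 Pnext late pq M [D hD]; have m0 : (0 < m)%N by exact: leq_trans m3.
(* [D] itself is the halting test: equality of the means will mean divergence of [P 1], strict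
   inequality halting. *)
apply: (halting_undecidable P01 Pnext); exists D => n.
have [d Dd hd] := hD n; exists d => //.
have [[y [s ts]]|nt] := pselect (terminates (P 1%N) n); last first.
  left; split=> //; suff Mcst r : M r n = 5.
    by case: hd => -[-> //]; rewrite !Mcst ltxx.
  rewrite /M -[RHS](@power_mean_cst R m m0 (ratr r)) //; congr power_mean.
  by apply/funext => i; rewrite crn_val_b_nonterm //; apply: late_not_terminates late nt _.
right; split; last by exists y, s.
have bE (i : 'I_m) : crn_val R (b_crn (P i.+1) n) = 5 + 2 ^- (s + i).
  by apply: crn_val_b_term; apply: late_terminates_at late ts _.
have : M p n < M q n.
  (* The first two values, [5 + 2 ^- s] and [5 + 2 ^- s.+1], witness that the family is not
     constant. *)
  apply: (@power_mean_lt R m m0 _ _ _ (Ordinal m0) (Ordinal (ltnW m3))).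
  - by move=> i; rewrite bE addr_gt0 // invr_gt0 exprn_gt0.
  - by rewrite ltr_rat.
  rewrite !bE /= (inj_eq (addrI _)) (inj_eq invr_inj) addn0 addn1 lt_eqF //.
  by rewrite ltr_eXn2l ?ltr1n.
by case: hd => -[-> //] ->; rewrite ltxx.
Qed.
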